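(* The real Banach space $\ell_\infty$ (bounded real sequences with the supremum norm) has the Bishop-Phelps-Bollobás property for numerical radius (BPBp-nu).
   Context: For a Banach space $X$, $S_X$ denotes the unit sphere, $X^*$ the topological dual, $\mathcal{L}(X)$ the space of bounded linear operators from $X$ to $X$, and $\Pi(X)=\{(x,x^* )\in S_X\times S_{X^*}: x^*(x)=1\}$. For $T\in\mathcal{L}(X)$ the numerical radius is $\nu(T)=\sup\{|x^*(Tx)|:(x,x^* )\in\Pi(X)\}$. BPBp-nu: $X$ has the BPBp-nu if for every $0<\varepsilon<1$ there exists $\eta(\varepsilon)>0$ such that whenever $T\in\mathcal{L}(X)$ and $(x_0,x_0^* )\in\Pi(X)$ satisfy $\nu(T)=1$ and $|x_0^*(Tx_0)|>1-\eta(\varepsilon)$, there exist $S\in\mathcal{L}(X)$ and $(x_1,x_1^* )\in\Pi(X)$ such that $\nu(S)=|x_1^*(Sx_1)|=1$, $\|S-T\|<\varepsilon$, $\|x_1-x_0\|<\varepsilon$ and $\|x_1^*-x_0^*\|<\varepsilon$. *)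

(* Defs.v *)
From HB Require Import structures.
From mathcomp Require Import all_boot all_order all_algebra.
From mathcomp Require Import all_classical all_reals all_analysis.
From mathcomp Require Import ring lra.

Set Implicit Arguments.
Unset Strict Implicit.
Unset Printing Implicit Defensive.

Import Order.TTheory GRing.Theory Num.Theory.
Import numFieldNormedType.Exports.

Local Open Scope classical_set_scope.
Local Open Scope ring_scope.

Section NumericalRadius.
Context {R : realType}.

(* The supremum is the usual operator norm when [f] is a bounded linear map;
   [sup] of an unbounded set is 0. *)
Definition opnorm {X Y : normedModType R} (f : X -> Y) : R :=
  sup [set `|f x| | x in [set x : X | `|x| <= 1]].

(* By [linear_boundedP], [bounded_near T (nbhs 0)] means |T x| <= M |x| for
   some M; by [linear_bounded_continuous], it is equivalent to continuity. *)
Definition bounded_operators (X : normedModType R) : set {linear X -> X} :=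
  [set T | bounded_near T (nbhs (0 : X))].

Definition topological_dual (X : normedModType R) : set {linear X -> R^o} :=
  [set f | continuous f].

Definition Pi_set (X : normedModType R) : set (X * {linear X -> R^o}) :=
  [set p | [/\ `|p.1| = 1, topological_dual p.2, opnorm p.2 = 1
             & p.2 p.1 = 1]].

Definition numerical_radius (X : normedModType R) (T : X -> X) : R :=
  sup [set `|p.2 (T p.1)| | p in @Pi_set X].

Definition BPBp_nu (X : completeNormedModType R) : Prop :=
  forall e : R, 0 < e < 1 -> exists2 eta : R, 0 < eta &
  forall (T : {linear X -> X}) (x0 : X) (f0 : {linear X -> R^o}),
    bounded_operators T -> Pi_set (x0, f0) ->
    numerical_radius T = 1 -> `|f0 (T x0)| > 1 - eta ->
    exists (S : {linear X -> X}) (x1 : X) (f1 : {linear X -> R^o}),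
      [/\ bounded_operators S, Pi_set (x1, f1) &
          [/\ numerical_radius S = 1, `|f1 (S x1)| = 1,
              opnorm (S \- T) < e, `|x1 - x0| < e & opnorm (f1 \- f0) < e]].

End NumericalRadius.

Section Linfty.
Variable R : realType.

Record linfty := Linfty {
  linfty_val :> nat -> R^o;
  linfty_bounded : linfty_val \in bounded_fun }.

HB.instance Definition _ := [isSub for linfty_val].
HB.instance Definition _ := [Choice of linfty by <:].

Lemma bounded_funE (x : nat -> R^o) :
  x \in bounded_fun <-> exists M, forall n, `|x n| <= M.
Proof.
have E := @ex_bound _ _ _ x _ (globally_properfilter (I : [set: nat] 0%N)).
rewrite inE; split=> [/E[M xM]|[M xM]]; first by exists M => n; exact: xM.
by apply/E; exists M => n _; exact: xM.
Qed.

Lemma linfty_submod_closed : submod_closed (mem (bounded_fun : set (nat -> R^o))).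
Proof.
split; first by apply/bounded_funE; exists 0 => n; rewrite normr0.
move=> a x y /bounded_funE[M xM] /bounded_funE[N yN].
apply/bounded_funE; exists (`|a| * M + N) => n.
apply: (le_trans (ler_normD _ _)); apply: lerD => //.
by rewrite normrZ ler_wpM2l.
Qed.

HB.instance Definition _ :=
  GRing.SubChoice_isSubLmodule.Build R (nat -> R^o) _ linfty linfty_submod_closed.

Definition linfty_norm (x : linfty) : R := sup (range (fun n => `|x n|)).

Lemma linfty_has_sup (x : linfty) : has_sup (range (fun n => `|x n|)).
Proof.
have /bounded_funE[M xM] := linfty_bounded x.
by split; [exists `|x 0%N|, 0%N|exists M => _ [n _ <-]].
Qed.

Lemma le_linfty_norm (x : linfty) n : `|x n| <= linfty_norm x.
Proof. by apply: ub_le_sup; [case: (linfty_has_sup x)|exists n]. Qed.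

Lemma linfty_norm_le (x : linfty) M : (forall n, `|x n| <= M) -> linfty_norm x <= M.
Proof.
by move=> xM; apply: ge_sup; [case: (linfty_has_sup x)|move=> _ [n _ <-]].
Qed.

Lemma linfty_normD (x y : linfty) :
  linfty_norm (x + y) <= linfty_norm x + linfty_norm y.
Proof.
apply: linfty_norm_le => n; apply: (le_trans (ler_normD _ _)).
by apply: lerD; exact: le_linfty_norm.
Qed.

Lemma linfty_normZ (a : R) (x : linfty) :
  linfty_norm (a *: x) = `|a| * linfty_norm x.
Proof.
apply/le_anti/andP; split.
  apply: linfty_norm_le => n.
  by rewrite normrZ ler_wpM2l// le_linfty_norm.
have [->|a0] := eqVneq a 0.
  by rewrite normr0 mul0r (le_trans (normr_ge0 _) (le_linfty_norm _ 0%N)).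
rewrite -ler_pdivlMl ?normr_gt0//; apply: linfty_norm_le => n.
rewrite ler_pdivlMl ?normr_gt0// -normrZ.
exact: (le_linfty_norm (a *: x) n).
Qed.

Lemma linfty_norm_eq0 (x : linfty) : linfty_norm x = 0 -> x = 0.
Proof.
move=> x0; apply/val_inj/funext => n; apply/normr0_eq0/le_anti.
by rewrite normr_ge0 -x0 le_linfty_norm.
Qed.

HB.instance Definition _ :=
  Lmodule_isNormed.Build R linfty linfty_normD linfty_normZ linfty_norm_eq0.

Lemma linfty_normE (x : linfty) : `|x| = sup (range (fun n => `|x n|)).
Proof. by []. Qed.

Lemma linfty_complete (F : set_system linfty) :
  ProperFilter F -> cauchy F -> cvg F.
Proof.
move=> FF Fc.
have Fn (n : nat) : cvg ((fun x : linfty => x n) @ F).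
  apply: R_complete; apply/cauchyP => e e0.
  have /cauchyP/(_ _ e0)[x Fx] := Fc; exists (x n).
  suff: F [set y : linfty | ball (x n) e (y n)] by [].
  apply: filterS Fx => y; rewrite -!ball_normE /=; apply: le_lt_trans.
  exact: (le_linfty_norm (x - y) n).
pose l n : R^o := lim ((fun x : linfty => x n) @ F).
have Fl (e : R) : 0 < e -> F [set y : linfty | forall n, `|l n - y n| <= e].
  move=> e0; have e30 : 0 < e / 3 by rewrite divr_gt0.
  have /cauchyP/(_ _ e30)[x Fx] := Fc.
  have xle y : ball x (e / 3) y -> forall n, `|x n - y n| <= e / 3.
    rewrite -ball_normE /= => /ltW xy n.
    by apply: le_trans xy; exact: (le_linfty_norm (x - y) n).
  apply: filterS (Fx) => y xy n.
  have Fln : F [set z : linfty | `|l n - z n| < e / 3].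
    by have /cvgrPdist_lt := Fn n; exact.
  have [z [xz lz]] := filter_ex (filterI Fx Fln).
  have -> : l n - y n = (l n - z n) + ((x n - y n) - (x n - z n)).
    by ring.
  apply: (le_trans (ler_normD _ _)).
  apply: (@le_trans _ _ (e / 3 + (e / 3 + e / 3))); last by lra.
  apply: lerD; first exact: ltW.
  by apply: (le_trans (ler_normB _ _)); apply: lerD; exact: xle.
have lb : l \in bounded_fun.
  have [y yl] := filter_ex (Fl 1 ltr01).
  apply/bounded_funE; exists (1 + `|y|) => n.
  rewrite -(subrK (y n) (l n)) (le_trans (ler_normD _ _))// lerD//.
  exact: le_linfty_norm.
apply/cvg_ex; exists (Linfty lb); apply/cvgrPdist_le => e e0.
apply: filterS (Fl e e0) => y yl; apply: linfty_norm_le => n; exact: yl.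
Qed.

HB.instance Definition _ := Uniform_isComplete.Build linfty linfty_complete.

End Linfty.

(* Main.v *)
From HB Require Import structures.
Require Import Defs.
From mathcomp Require Import all_boot all_order all_algebra.
From mathcomp Require Import all_classical all_reals all_analysis.
From mathcomp Require Import ring lra.

(* Let c be the sign of x0 on {|x0| >= 1 - d} and 0 elsewhere, and let x1 equal
   c where c <> 0 and x0 elsewhere, so that |x1 - x0| <= d.  The functional f0
   attains its norm at x0, hence it only sees the coordinates with c <> 0, where
   after multiplication by c it is positive of mass 1.  Since f0 (T x0) is close
   to +-1 =: s, Markov's inequality shows that nearly all of that mass sits on
   B = {n | s c_n (T x0)_n > 1 - h}; let f1 be f0 restricted to B and normalised.
   For n in B the row z |-> s c_n (T z)_n nearly attains its norm at x0, so it is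
   close to its restriction to {c <> 0}, and this one to its positive part with
   respect to c, which attains its norm at x1 whatever n is.  Replacing these
   rows by the normalised positive parts yields S.  The numerical radius of an
   operator on l_infty is its norm, because every z in the unit ball is a convex
   combination of vectors of norm 1 whose n-th coordinate is 1 or -1. *)

Set Implicit Arguments.
Unset Strict Implicit.
Unset Printing Implicit Defensive.

Import Order.TTheory GRing.Theory Num.Theory.
Import numFieldNormedType.Exports.

Local Open Scope classical_set_scope.
Local Open Scope ring_scope.

(** Maps below are built as plain functions with a linearity proof; this bundles them into the type
    that [BPBp_nu] quantifies over. *)
Lemma exists_linear (R : realType) (U V : lmodType R) (f : U -> V) :
  linear f -> exists g : {linear U -> V}, g =1 f.
Proof.
move=> lf.
pose m := GRing.isLinear.Build R U V *:%R f lf.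
pose g : {linear U -> V} := HB.pack f m.
by exists g.
Qed.

(** * Coordinatewise calculus and functionals on [linfty] *)

Section Linfty.
Variable R : realType.
Implicit Types (x y z u v w : linfty R) (a b : R).

(* Junk value 0 when [s] is unbounded. *)
Definition seq_linfty (s : nat -> R) : linfty R :=
  insubd (0 : linfty R) (s : nat -> R^o).

Lemma seq_linftyE (s : nat -> R) b : (forall n, `|s n| <= b) ->
  forall n, seq_linfty s n = s n.
Proof.
move=> sb n; have sbd : (s : nat -> R^o) \in bounded_fun.
  by apply/bounded_funE; exists b.
by rewrite -[LHS]/(\val (seq_linfty s) n) insubdK.
Qed.

Lemma linfty_ext x y : x =1 y -> x = y.
Proof. by move=> xy; apply/val_inj/funext. Qed.

Lemma linftyD x y n : (x + y) n = x n + y n. Proof. by []. Qed.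
Lemma linftyN x n : (- x) n = - x n. Proof. by []. Qed.
Lemma linftyZ a x n : (a *: x) n = a * x n. Proof. by []. Qed.
Lemma linfty0 n : (0 : linfty R) n = 0. Proof. by []. Qed.
Definition linftyE := (linftyD, linftyN, linftyZ, linfty0).

Lemma coord_le x n : `|x n| <= `|x|. Proof. exact: le_linfty_norm. Qed.

Definition cst_linfty a := seq_linfty (fun=> a).

Lemma cst_linftyE a n : cst_linfty a n = a.
Proof. exact: (@seq_linftyE (fun=> a) `|a|). Qed.

Definition mul_linfty (c : nat -> R) x := seq_linfty (fun n => c n * x n).

Lemma mul_linftyE (c : nat -> R) x : (forall n, `|c n| <= 1) ->
  forall n, mul_linfty c x n = c n * x n.
Proof.
move=> c1; apply: (@seq_linftyE _ `|x|) => n.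
by rewrite normrM -[leRHS]mul1r ler_pM ?coord_le.
Qed.

Lemma mul_linfty_linear (c : nat -> R) : (forall n, `|c n| <= 1) ->
  linear (mul_linfty c).
Proof.
move=> c1 a x y; apply: linfty_ext => n.
by rewrite mul_linftyE// !linftyE !mul_linftyE//; ring.
Qed.

Lemma mul_linfty_le (c : nat -> R) x : (forall n, `|c n| <= 1) ->
  `|mul_linfty c x| <= `|x|.
Proof.
move=> c1; apply: linfty_norm_le => n; rewrite mul_linftyE// normrM.
by rewrite -[leRHS]mul1r ler_pM ?coord_le.
Qed.

(** A predicate rather than the bundled type: functionals arise here from formulas and existence
    statements, and their values stay in [R]. *)
Definition functional (L : linfty R -> R) := linear (L : linfty R -> R^o).

Section Functional.
Variable L : linfty R -> R.
Hypothesis linL : functional L.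

Lemma functionalD x y : L (x + y) = L x + L y.
Proof. by have := linL 1 x y; rewrite !scale1r. Qed.

Lemma functional0 : L 0 = 0.
Proof. by have := functionalD 0 0; rewrite addr0; lra. Qed.

Lemma functionalZ a x : L (a *: x) = a * L x.
Proof. by have := linL a x 0; rewrite !addr0 functional0 addr0. Qed.

Lemma functionalN x : L (- x) = - L x.
Proof. by rewrite -scaleN1r functionalZ mulN1r. Qed.

Lemma functionalB x y : L (x - y) = L x - L y.
Proof. by rewrite functionalD functionalN. Qed.

Definition functionalE :=
  (functionalB, functionalD, functionalZ, functionalN, functional0).

(** Positivity is applied to [u + w] and to [u - w]. *)
Lemma positive_functional_le : (forall u, (forall n, 0 <= u n) -> 0 <= L u) ->
  forall w u, (forall n, `|w n| <= u n) -> `|L w| <= L u.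
Proof.
move=> L0 w u wu; rewrite ler_norml; apply/andP; split.
  suff : 0 <= L (u + w) by rewrite functionalE; lra.
  by apply: L0 => n; have := wu n; rewrite !linftyE ler_norml; lra.
suff : 0 <= L (u - w) by rewrite functionalE; lra.
by apply: L0 => n; have := wu n; rewrite !linftyE ler_norml; lra.
Qed.

End Functional.

(** * The positive part of a functional *)

(* Riesz' formula for the positive part of a functional on the positive cone. *)
Definition pos_sup (L : linfty R -> R) u : R :=
  sup [set L v | v in [set v : linfty R | forall n, 0 <= v n <= u n]].

Section PosSup.
Variable L : linfty R -> R.
Hypothesis linL : functional L.
Hypothesis L1 : forall z, `|L z| <= `|z|.

Lemma pos_sup_ub u v : (forall n, 0 <= v n <= u n) -> L v <= pos_sup L u.
Proof.
move=> vu; apply: ub_le_sup; last by exists v.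
exists `|u| => _ [w wu <-]; apply: (le_trans (ler_norm _)).
apply: (le_trans (L1 w)); apply: linfty_norm_le => n.
by have := wu n; have := coord_le u n; rewrite !ler_norml; lra.
Qed.

Lemma pos_sup_le u b : (forall n, 0 <= u n) ->
  (forall v, (forall n, 0 <= v n <= u n) -> L v <= b) -> pos_sup L u <= b.
Proof.
move=> u0 ub; apply: ge_sup; last by move=> _ [v vu <-]; exact: ub.
by exists (L 0), 0 => // n; rewrite linfty0 lexx u0.
Qed.

Lemma pos_sup_ge0 u : (forall n, 0 <= u n) -> 0 <= pos_sup L u.
Proof.
move=> u0; rewrite -(functional0 linL); apply: pos_sup_ub => n.
by rewrite linfty0 lexx u0.
Qed.

(** Riesz decomposition: any [w] between 0 and [u + v] splits as [min w u] plus a remainder between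
    0 and [v]. *)
Lemma pos_supD u v : (forall n, 0 <= u n) -> (forall n, 0 <= v n) ->
  pos_sup L (u + v) = pos_sup L u + pos_sup L v.
Proof.
move=> u0 v0; apply/le_anti/andP; split.
  apply: pos_sup_le => [n|w wuv].
    by have := u0 n; have := v0 n; rewrite linftyE; lra.
  pose p := seq_linfty (fun n => Num.min (w n) (u n)).
  have pE n : p n = Num.min (w n) (u n).
    apply: (@seq_linftyE _ `|u|) => m; apply: le_trans (coord_le u m).
    have := wuv m; have := u0 m; rewrite (ger0_norm (u0 m)) ler_norml.
    by case: (leP (w m) (u m)); lra.
  have -> : w = p + (w - p) by rewrite addrC subrK.
  rewrite functionalD// lerD// pos_sup_ub// => n.
    by rewrite pE; have := wuv n; have := u0 n; case: (leP (w n) (u n)); lra.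
  rewrite !linftyE pE; have := wuv n; have := u0 n; have := v0 n.
  by rewrite linftyE; case: (leP (w n) (u n)); lra.
have : pos_sup L u <= pos_sup L (u + v) - pos_sup L v.
  apply: pos_sup_le => // p pu.
  suff : pos_sup L v <= pos_sup L (u + v) - L p by lra.
  apply: pos_sup_le => // q qv.
  suff : L (p + q) <= pos_sup L (u + v) by rewrite functionalD//; lra.
  apply: pos_sup_ub => n; rewrite !linftyE; have := pu n; have := qv n; lra.
lra.
Qed.

(** One inequality is rescaling; the other is the same one for [a^-1] and [a *: u]. *)
Lemma pos_supZ a u : 0 < a -> (forall n, 0 <= u n) ->
  pos_sup L (a *: u) = a * pos_sup L u.
Proof.
have half b v : 0 < b -> (forall n, 0 <= v n) ->
    pos_sup L (b *: v) <= b * pos_sup L v.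
  move=> b0 v0; apply: pos_sup_le => [n|w wv].
    by rewrite linftyE mulr_ge0// ltW.
  rewrite -ler_pdivrMl// -functionalZ//; apply: pos_sup_ub => n.
  have := wv n; rewrite !linftyE => /andP[w0 wbv].
  by rewrite mulr_ge0 ?invr_ge0 ?(ltW b0)//= ler_pdivrMl.
move=> a0 u0; apply/le_anti/andP; split; first exact: half.
rewrite -ler_pdivlMl//.
rewrite [X in pos_sup L X <= _](_ : u = a^-1 *: (a *: u)); last first.
  by rewrite scalerA mulVf ?scale1r// gt_eqF.
apply: half => [|n]; first by rewrite invr_gt0.
by rewrite linftyE mulr_ge0// ltW.
Qed.

(** [pos_sup L] is additive and positively homogeneous on the cone, so it extends by differences; a
    bounded sequence becomes positive after adding a constant, so constants suffice as
    subtrahends. *)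
Lemma exists_positive_part : exists P : linfty R -> R, functional P /\
  forall u, (forall n, 0 <= u n) -> P u = pos_sup L u.
Proof.
pose one := cst_linfty 1.
have oneE n : one n = 1 by exact: cst_linftyE.
have shift_ge0 z b : `|z| <= b -> forall n, 0 <= (z + b *: one) n.
  move=> zb n; have := le_trans (coord_le z n) zb.
  by rewrite !linftyE oneE ler_norml; lra.
have one_ge0 b : 0 <= b -> forall n, 0 <= (b *: one) n.
  by move=> b0 n; rewrite !linftyE oneE mulr1.
(* [z = (z + a) - a] with both terms positive as soon as [|z| <= a]. *)
pose Q z a := pos_sup L (z + a *: one) - pos_sup L (a *: one).
have addr_swap (p q r s : R) : p + q = r + s -> p - s = r - q by lra.
have QE z a b : `|z| <= a -> `|z| <= b -> Q z a = Q z b.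
  move=> za zb; have a0 := le_trans (normr_ge0 z) za.
  have b0 := le_trans (normr_ge0 z) zb; rewrite /Q.
  (* Independence of the shift: additivity splits [z + a *: one + b *: one] in two ways. *)
  have := congr1 (pos_sup L) (addrAC z (a *: one) (b *: one)).
  rewrite (pos_supD (shift_ge0 _ _ za) (one_ge0 _ b0)).
  by rewrite (pos_supD (shift_ge0 _ _ zb) (one_ge0 _ a0)) => /addr_swap.
pose P z := Q z `|z|.
have PE z a : `|z| <= a -> P z = Q z a by move=> za; exact: QE.
have PD x y : P (x + y) = P x + P y.
  rewrite (PE _ _ (ler_normD x y)) /P /Q scalerDl addrACA.
  rewrite (pos_supD (shift_ge0 _ _ (lexx `|x|)) (shift_ge0 _ _ (lexx `|y|))).
  rewrite (pos_supD (one_ge0 _ (normr_ge0 x)) (one_ge0 _ (normr_ge0 y))).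
  by rewrite opprD addrACA.
have P0 u : (forall n, 0 <= u n) -> P u = pos_sup L u.
  move=> u0; rewrite /P /Q (pos_supD u0 (one_ge0 _ (normr_ge0 u))).
  by rewrite addrK.
have P00 : P 0 = 0 by apply: (addrI (P 0)); rewrite -PD !addr0.
have PZ a x : 0 < a -> P (a *: x) = a * P x.
  move=> a0; rewrite /P /Q normrZ gtr0_norm// -scalerA -scalerDr.
  rewrite (pos_supZ a0 (shift_ge0 _ _ (lexx `|x|))).
  by rewrite (pos_supZ a0 (one_ge0 _ (normr_ge0 x))) mulrBr.
have PN x : P (- x) = - P x.
  by apply/esym/addr0_eq; rewrite -PD subrr.
exists P; split=> // a x y; rewrite PD; congr (_ + _).
case: (ltgtP a 0) => [a0|a0|->]; last 1 first.
- by rewrite !scale0r.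
- by rewrite -[in LHS](opprK a) scaleNr PN PZ ?oppr_gt0// mulNr opprK.
- exact: PZ.
Qed.

End PosSup.

(** * The peaks of [x0] and the vector snapped to them *)

Section Peak.
Variables (x0 : linfty R) (d : R).
Hypotheses (x0_1 : `|x0| <= 1) (d0 : 0 < d) (d12 : d <= 1 / 2).

(** The sign sequence [c] described at the top; [snap] is the vector [x1]. *)
Definition peak n : R :=
  if 1 - d <= x0 n then 1 else if x0 n <= - (1 - d) then -1 else 0.

Definition snap_fun n : R := if peak n == 0 then x0 n else peak n.

Definition snap : linfty R := seq_linfty snap_fun.

Lemma peakP n : [\/ peak n = 0 /\ `|x0 n| <= 1 - d,
  peak n = 1 /\ 1 - d <= x0 n <= 1 | peak n = -1 /\ -1 <= x0 n <= - (1 - d)].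
Proof.
have := le_trans (coord_le x0 n) x0_1; rewrite /peak !ler_norml.
case: ifPn => [x0d x0n|]; first by constructor 2; split=> //; lra.
rewrite -ltNge => x0d; case: ifPn => [x0d' x0n|].
  by constructor 3; split=> //; lra.
by rewrite -ltNge => x0d' x0n; constructor 1; split=> //; lra.
Qed.

Lemma peak_le1 n : `|peak n| <= 1.
Proof. by case: (peakP n) => -[-> _]; rewrite ?normrN ?normr1 ?normr0. Qed.

Lemma snapE n : snap n = snap_fun n.
Proof.
apply: (seq_linftyE (b := 1)) => m; rewrite /snap_fun; case: ifPn => _.
  exact: le_trans (coord_le _ _) x0_1.
exact: peak_le1.
Qed.

(** The factor [peak n] absorbs the case [peak n = 0], so the product is the indicator of the peaks,
    whatever [x0] is elsewhere. *)
Lemma peak_snap n : peak n * snap n = peak n * peak n.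
Proof.
by rewrite snapE /snap_fun; case: ifPn => [/eqP ->|//]; rewrite !mul0r.
Qed.

Lemma snap_le1 : `|snap| <= 1.
Proof.
apply: linfty_norm_le => n; rewrite snapE /snap_fun; case: ifPn => _.
  exact: le_trans (coord_le _ _) x0_1.
exact: peak_le1.
Qed.

Lemma snap_near : `|snap - x0| <= d.
Proof.
apply: linfty_norm_le => n; rewrite !linftyE snapE /snap_fun ler_norml.
by case: (peakP n) => -[->]; rewrite ?eqxx ?oppr_eq0 ?oner_eq0 /=;
  move: d0 d12; lra.
Qed.

Local Notation C := (mul_linfty peak).

Lemma CE z n : C z n = peak n * z n.
Proof. by apply: mul_linftyE; exact: peak_le1. Qed.

(** * Functionals that nearly attain their norm at [x0] *)

Section NearlyAttaining.
Variables (L : linfty R -> R) (t : R).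
Hypothesis linL : functional L.
Hypothesis L1 : forall z, `|L z| <= `|z|.
Hypothesis Lx0 : 1 - t <= L x0.

Let t0 : 0 <= t.
Proof. by have := L1 x0; rewrite ler_norml; move: x0_1 Lx0; lra. Qed.

(* Off the peaks, [x0] may be moved by [d] without leaving the unit ball. *)
Lemma off_peak z : `|z| <= 1 -> `|L z - L (C (C z))| <= t / d.
Proof.
have sub y : `|y| <= 1 -> L y - L (C (C y)) <= t / d.
  move=> y1; rewrite ler_pdivlMr//.
  have : `|x0 + d *: (y - C (C y))| <= 1.
    apply: linfty_norm_le => n; rewrite !linftyE !CE.
    have : `|d * y n| <= d.
      rewrite normrM (gtr0_norm d0) ler_piMr ?(ltW d0)//.
      exact: le_trans (coord_le y n) y1.
    by case: (peakP n) => -[->]; rewrite !ler_norml; move: d0 d12; lra.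
  move=> /(le_trans (L1 _)).
  rewrite ler_norml (functionalD linL) (functionalZ linL) (functionalB linL).
  move: Lx0; lra.
move=> z1; rewrite ler_norml sub// andbT.
have := sub (- z); rewrite normrN => /(_ z1).
have -> : C (C (- z)) = - C (C z).
  by apply: linfty_ext => n; rewrite !(CE, linftyE); ring.
by rewrite !(functionalN linL); lra.
Qed.

(* On the peaks, subtracting [2 (1 - d) c v] from [x0] stays in the unit ball. *)
Lemma on_peak v : (forall n, 0 <= v n <= 1) -> - L (C v) <= t.
Proof.
move=> v01; have : `|x0 - (2 * (1 - d)) *: C v| <= 1.
  apply: linfty_norm_le => n; rewrite !linftyE !CE.
  have /andP[v0 v1] := v01 n; have d1 : 0 <= 1 - d by move: d12; lra.
  have : 0 <= (1 - d) * v n by rewrite mulr_ge0.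
  have : (1 - d) * v n <= 1 - d by rewrite ler_piMr.
  by case: (peakP n) => -[->]; rewrite !ler_norml; move: d0 d12; lra.
move=> /(le_trans (L1 _)).
rewrite ler_norml (functionalB linL) (functionalZ linL) => /andP[_ h].
have [K0|K0] := leP 0 (L (C v)); first by move: t0; lra.
by move: h K0 Lx0 d12; nra.
Qed.

(** With [P] the positive part of [K z = L (C z)], the witness is [M z = P (C z) / P one].
    Normalising costs [t + t / d], passing from [P] to [K] costs [t], and dropping the coordinates
    off the peaks costs [t / d]. *)
Lemma nearly_attaining_correction : t + t / d < 1 ->
  exists M : linfty R -> R, [/\ functional M, forall z, `|M z| <= `|z|,
    M snap = 1 & forall z, `|z| <= 1 -> `|M z - L z| <= 2 * (t + t / d)].
Proof.
move=> td.
pose K z := L (C z).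
have linK : functional K.
  by move=> a x y; rewrite /K (mul_linfty_linear peak_le1) linL.
have K1 z : `|K z| <= `|z|.
  by apply: (le_trans (L1 _)); apply: mul_linfty_le; exact: peak_le1.
have [P [linP PE]] := exists_positive_part linK K1.
pose one := cst_linfty 1.
have oneE n : one n = 1 by exact: cst_linftyE.
have P0 u : (forall n, 0 <= u n) -> 0 <= P u.
  by move=> u0; rewrite PE//; exact: pos_sup_ge0.
have KP u v : (forall n, 0 <= v n <= u n) -> K v <= P u.
  move=> vu; rewrite PE; first exact: pos_sup_ub.
  by move=> n; have := vu n; lra.
have Ple u b : (forall n, 0 <= u n) ->
    (forall v, (forall n, 0 <= v n <= u n) -> K v <= b) -> P u <= b.
  by move=> u0 ub; rewrite PE//; exact: pos_sup_le.
clear PE.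
have P1 : P one <= 1.
  apply: Ple => [n|v v1]; first by rewrite oneE.
  apply: (le_trans (ler_norm _)); apply: (le_trans (K1 _)).
  apply: linfty_norm_le => n; have := v1 n; rewrite oneE ler_norml; lra.
have one0 n : 0 <= one n by rewrite oneE.
(* [C x0] lies between 0 and [one], and [K (C x0) = L (C (C x0))] is within [t / d] of [L x0]. *)
have Pge : 1 - t - t / d <= P one.
  have x0C : K (C x0) <= P one.
    apply: KP => n; rewrite CE oneE.
    by case: (peakP n) => -[->]; rewrite ?ler_norml; move: d0 d12; lra.
  by have := off_peak x0_1; move: x0C Lx0; rewrite /K ler_norml; lra.
have Ppos : 0 < P one by move: Pge td; lra.
(* [P - K] is the negative part of [K], a positive functional; its value at [one] is a supremum of
   terms [- K (one - v)], each at most [t] by [on_peak]. *)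
have PK w : (forall n, `|w n| <= 1) -> `|P w - K w| <= t.
  move=> w1; pose D z := P z - K z.
  have linD : functional D.
    move=> a x y; rewrite /D linP linK.
    by rewrite -[LHS]/(a * P x + P y - (a * K x + K y))
               -[RHS]/(a * (P x - K x) + (P y - K y)); ring.
  have D0 u : (forall n, 0 <= u n) -> 0 <= D u.
    by move=> u0; rewrite subr_ge0; apply: KP => n; rewrite u0 lexx.
  have D1 : D one <= t.
    rewrite lerBlDl; apply: Ple => // v v1.
    suff : - K (one - v) <= t by rewrite (functionalB linK); lra.
    by apply: on_peak => n; have := v1 n; rewrite !linftyE oneE; lra.
  apply: le_trans D1; apply: (positive_functional_le linD D0) => n.
  by rewrite oneE.
have PC z : `|P (C z)| <= P one * `|z|.
  have -> : P one * `|z| = P (`|z| *: one) by rewrite (functionalZ linP) mulrC.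
  apply: (positive_functional_le linP P0) => n.
  rewrite linftyE oneE mulr1; apply: le_trans (coord_le _ _) _.
  by apply: mul_linfty_le; exact: peak_le1.
exists (fun z => P (C z) / P one).
(* [C snap] is the indicator of the peaks, and [P] vanishes on the complementary indicator because
   [K] vanishes on everything between 0 and it. *)
have Psnap : P (C snap) = P one.
  have -> : C snap = C (C one).
    by apply: linfty_ext => n; rewrite !CE peak_snap oneE mulr1.
  have -> : C (C one) = one - (one - C (C one)) by rewrite opprB addrC subrK.
  rewrite (functionalB linP); suff -> : P (one - C (C one)) = 0 by rewrite subr0.
  have u0 n : 0 <= (one - C (C one)) n.
    rewrite !linftyE !CE oneE.
    by case: (peakP n) => -[-> _]; rewrite ?mulr1 ?mulrNN ?mulr0; lra.
  apply/le_anti; rewrite P0// andbT; apply: Ple => // v vu.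
  suff -> : v = v - C (C v).
    rewrite /K; suff -> : C (v - C (C v)) = 0 by rewrite (functional0 linL).
    apply: linfty_ext => n; rewrite !(CE, linftyE).
    by case: (peakP n) => -[-> _]; ring.
  apply: linfty_ext => n; rewrite !(CE, linftyE).
  have := vu n; rewrite !linftyE !CE oneE.
  by case: (peakP n) => -[-> _]; rewrite ?mulr1 ?mulrNN ?mulr0; lra.
split.
- move=> a x y; rewrite (mul_linfty_linear peak_le1) linP.
  by rewrite -[LHS]/((a * P (C x) + P (C y)) / P one)
             -[RHS]/(a * (P (C x) / P one) + P (C y) / P one); ring.
- move=> z; rewrite normrM normfV (gtr0_norm Ppos) ler_pdivrMr// mulrC.
  exact: PC.
- by rewrite Psnap divff ?gt_eqF.
- move=> z z1.
  have PCz : `|P (C z) / P one - P (C z)| <= 1 - P one.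
    have -> : P (C z) / P one - P (C z) = P (C z) / P one * (1 - P one).
      by field; rewrite gt_eqF.
    rewrite normrM [X in _ * X]ger0_norm ?subr_ge0// ler_piMl ?subr_ge0//.
    rewrite normrM normfV (gtr0_norm Ppos) ler_pdivrMr// mul1r.
    by apply: (le_trans (PC z)); rewrite ler_piMr// ltW.
  have PKCz : `|P (C z) - K (C z)| <= t.
    apply: PK => n; apply: le_trans (coord_le _ _) _.
    by apply: le_trans z1; apply: mul_linfty_le; exact: peak_le1.
  have := off_peak z1; move: PCz PKCz Pge; rewrite -/(K _) !ler_norml; lra.
Qed.

End NearlyAttaining.

(** * Functionals that attain their norm at [x0], and their restriction to a set [B] of indices *)

Section Attaining.
Variables (f : linfty R -> R) (B : nat -> bool).
Hypothesis linf : functional f.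
Hypothesis f1 : forall z, `|f z| <= `|z|.
Hypothesis fx0 : f x0 = 1.

Let D := mul_linfty (fun n => (B n)%:R).

Let DE z n : D z n = (B n)%:R * z n.
Proof. by apply: mul_linftyE => m; case: (B m); rewrite ?normr0 ?normr1. Qed.

(** [u |-> f (C u)] is a positive functional, that is, a finitely additive measure on the indices;
    this is its mass on [B]. *)
Definition peak_mass := f (C (D (cst_linfty 1))).

(** The form [1 - 0] matches the near-attainment hypothesis at [t = 0], where the bounds of
    [off_peak] and [on_peak] become 0. *)
Let fx0_ge : 1 - 0 <= f x0. Proof. by rewrite fx0 subr0. Qed.

Lemma peak_support z : `|z| <= 1 -> f (C (C z)) = f z.
Proof.
move=> z1; have := off_peak linf f1 fx0_ge z1.
by rewrite mul0r normr_le0 subr_eq0 => /eqP.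
Qed.

Let fC_linear : functional (fun z => f (C z)).
Proof. by move=> a x y; rewrite (mul_linfty_linear peak_le1) linf. Qed.

(** [on_peak] at [t = 0] covers sequences with values in [0, 1]; dividing by the norm reaches the
    others. *)
Let fC_ge0 u : (forall n, 0 <= u n) -> 0 <= f (C u).
Proof.
move=> u0; have [u00|u_neq0] := eqVneq `|u| 0.
  have -> : u = `|u| *: u by rewrite u00 scale0r; apply: normr0_eq0.
  by rewrite (functionalZ fC_linear) u00 mul0r.
have u_gt0 : 0 < `|u| by rewrite lt_neqAle eq_sym u_neq0 normr_ge0.
rewrite -(pmulr_rge0 _ (_ : 0 < `|u|^-1)) ?invr_gt0//.
rewrite -(functionalZ fC_linear) -oppr_le0; apply: (on_peak linf f1 fx0_ge) => n.
have -> : (`|u|^-1 *: u) n = u n / `|u| by rewrite linftyE mulrC.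
rewrite divr_ge0 ?u0//= ler_pdivrMr// mul1r.
exact: le_trans (ler_norm _) (coord_le u n).
Qed.

Let fC_le w u : (forall n, `|w n| <= u n) -> `|f (C w)| <= f (C u).
Proof. exact: (positive_functional_le fC_linear fC_ge0). Qed.

Let one := cst_linfty 1.
Let oneE n : one n = 1. Proof. exact: cst_linftyE. Qed.

Let fC1 : f (C one) <= 1.
Proof.
apply: (le_trans (ler_norm _)); apply: (le_trans (f1 _)).
apply: linfty_norm_le => n; rewrite CE oneE mulr1; exact: peak_le1.
Qed.

Lemma peak_mass_le1 : peak_mass <= 1.
Proof.
apply: le_trans fC1; apply: (le_trans (ler_norm _)); apply: fC_le => n.
by rewrite DE oneE; case: (B n); rewrite ?mul0r ?mul1r ?normr0 ?normr1.
Qed.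

(** Markov's inequality: [w] lies below [(1 - h) *: one + h *: D one], and [f (C _)] is monotone. *)
Lemma peak_mass_gt w (h r : R) : 0 < h <= 1 ->
  (forall n, w n <= 1) -> (forall n, ~~ B n -> w n <= 1 - h) ->
  1 - r * h < f (C w) -> 1 - r < peak_mass.
Proof.
move=> /andP[h0 h1] w1 wB fw.
have : 0 <= f (C ((1 - h) *: one + h *: D one - w)).
  apply: fC_ge0 => n; rewrite !linftyE DE oneE.
  by case: (boolP (B n)) => [_|/wB]; [have := w1 n|]; rewrite ?mul1r ?mul0r; lra.
rewrite (functionalB fC_linear) (functionalD fC_linear).
rewrite (functionalZ fC_linear (1 - h)) (functionalZ fC_linear h).
rewrite -[f (C (D one))]/peak_mass => fw'.
have hfC1 : (1 - h) * f (C one) <= 1 - h by rewrite ler_piMr// subr_ge0.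
have : 0 < h * (peak_mass - (1 - r)) by move: fw fw' hfC1; lra.
by rewrite pmulr_rgt0// subr_gt0.
Qed.

(** The witness is [f (C (D (C z))) / peak_mass]; cutting down to [B] and normalising each cost at
    most [1 - peak_mass]. The third clause later evaluates the new functional both at [snap] and at
    its image under [S]. *)
Lemma exists_localization : 0 < peak_mass ->
  exists f' : linfty R -> R, [/\ functional f', forall z, `|f' z| <= `|z|,
    forall z a, (forall n, B n -> peak n * z n = a) -> f' z = a &
    forall z, `|z| <= 1 -> `|f' z - f z| <= 2 * (1 - peak_mass)].
Proof.
move=> b0; have D1 n : `|(B n)%:R : R| <= 1.
  by case: (B n); rewrite ?normr0 ?normr1.
have linD : linear D := mul_linfty_linear D1.
have fCD w a : (forall n, `|w n| <= a) -> `|f (C (D w))| <= peak_mass * a.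
  move=> wa; have -> : peak_mass * a = f (C (a *: D one)).
    by rewrite (functionalZ fC_linear) mulrC.
  apply: fC_le => n; rewrite linftyE !DE oneE.
  by case: (B n); rewrite ?mul1r ?mul0r ?mulr0 ?normr0 ?mulr1.
exists (fun z => f (C (D (C z))) / peak_mass); split.
- move=> a x y; rewrite (mul_linfty_linear peak_le1) linD fC_linear.
  by rewrite -[LHS]/((a * f (C (D (C x))) + f (C (D (C y)))) / peak_mass)
    -[RHS]/(a * (f (C (D (C x))) / peak_mass) + f (C (D (C y))) / peak_mass);
    ring.
- move=> z; rewrite normrM normfV (gtr0_norm b0) ler_pdivrMr// mulrC.
  apply: fCD => n; apply: le_trans (coord_le _ _) _.
  exact: mul_linfty_le peak_le1.
- move=> z a Bz; have -> : D (C z) = a *: D one.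
    apply: linfty_ext => n; rewrite linftyE !DE CE oneE.
    by case: (boolP (B n)) => [/Bz ->|_]; rewrite ?mul0r ?mul1r ?mulr0 ?mulr1.
  by rewrite (functionalZ fC_linear) mulfK// gt_eqF.
- move=> z z1; have Cz n : `|C z n| <= 1.
    apply: le_trans (coord_le _ _) _; apply: le_trans z1.
    exact: mul_linfty_le peak_le1.
  have : `|f (C (C z)) - f (C (D (C z)))| <= 1 - peak_mass.
    rewrite -(functionalB fC_linear).
    apply: (@le_trans _ _ (f (C (one - D one)))); last first.
      by rewrite (functionalB fC_linear) lerB.
    apply: fC_le => n; rewrite !linftyE !DE oneE; have := Cz n.
    by case: (B n); rewrite ?mul1r ?mul0r ?subrr ?normr0 ?subr0.
  have : `|f (C (D (C z))) / peak_mass - f (C (D (C z)))| <= 1 - peak_mass.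
    have := fCD (C z) 1 Cz; move: (f (C (D (C z)))) => q; rewrite mulr1 => qb.
    have -> : q / peak_mass - q = q / peak_mass * (1 - peak_mass).
      by field; rewrite gt_eqF.
    have p1 : 0 <= 1 - peak_mass by rewrite subr_ge0 peak_mass_le1.
    rewrite normrM [X in _ * X]ger0_norm// ler_piMl//.
    by rewrite normrM normfV (gtr0_norm b0) ler_pdivrMr// mul1r.
  rewrite (peak_support z1); move: (f (C (D _))) (f z) => q r.
  by rewrite !ler_norml; lra.
Qed.

End Attaining.

End Peak.

End Linfty.

(** * Operator norm, the set [Pi_set] and the numerical radius *)

Section OperatorNorm.
Variable R : realType.

Lemma opnorm_le (X Y : normedModType R) (f : X -> Y) (M : R) :
  (forall x, `|x| <= 1 -> `|f x| <= M) -> opnorm f <= M.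
Proof.
move=> fM; apply: ge_sup; last by move=> _ [x x1 <-]; exact: fM.
by exists `|f 0|, 0 => //=; rewrite normr0.
Qed.

Lemma contraction_bounded (X Y : normedModType R) (f : {linear X -> Y}) :
  (forall x, `|f x| <= `|x|) -> bounded_near f (nbhs (0 : X)).
Proof.
move=> f1; apply/linear_boundedP; near=> r => x.
by apply: (le_trans (f1 x)); rewrite ler_peMl//; near: r; exact: nbhs_pinfty_ge.
Unshelve. all: by end_near. Qed.

Lemma contraction_Pi (X : normedModType R) (f : {linear X -> R^o}) (x : X) :
  (forall z, `|f z| <= `|z|) -> `|x| = 1 -> f x = 1 -> Pi_set (x, f).
Proof.
move=> f1 x1 fx; split=> //=.
  by apply/linear_bounded_continuous; exact: contraction_bounded.
apply/le_anti/andP; split; first by apply: opnorm_le => z; exact: le_trans.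
apply: ub_le_sup; last by exists x; rewrite /= ?x1// fx normr1.
by exists 1 => _ [z z1 <-]; exact: le_trans z1.
Qed.

(** A set without a supremum has [sup] equal to 0 by default, so the value 1 forces it to be
    nonempty and bounded above. *)
Lemma has_sup_eq1 (E : set R) : sup E = 1 -> has_sup E.
Proof.
move=> E1; apply: contrapT => /sup_out E0.
by move: E1; rewrite E0 => /eqP; rewrite eq_sym oner_eq0.
Qed.

Lemma Pi_contraction (X : normedModType R) (f : {linear X -> R^o}) (x : X) :
  Pi_set (x, f) -> forall z, `|f z| <= `|z|.
Proof.
move=> [_ _ /= f1 _] z; have [_ fub] := has_sup_eq1 f1.
have [->|z0] := eqVneq z 0; first by rewrite linear0 !normr0.
have nz0 : 0 < `|z| by rewrite normr_gt0.
have : `|f (`|z|^-1 *: z)| <= 1.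
  rewrite -f1; apply: ub_le_sup => //; exists (`|z|^-1 *: z) => //=.
  by rewrite normrZ normfV normr_id mulVf// gt_eqF.
by rewrite linearZ_LR normrZ normfV normr_id ler_pdivrMl// mulr1.
Qed.

Lemma numerical_radius_ge (X : normedModType R) (T : X -> X)
    (f : {linear X -> R^o}) (x : X) :
  numerical_radius T = 1 -> Pi_set (x, f) -> `|f (T x)| <= 1.
Proof.
move=> T1 xf; rewrite -T1; apply: ub_le_sup; last by exists (x, f).
by have [] := has_sup_eq1 T1.
Qed.

Lemma numerical_radius_attained (X : normedModType R) (T : X -> X)
    (f : {linear X -> R^o}) (x : X) :
  (forall z, `|T z| <= `|z|) -> Pi_set (x, f) -> `|f (T x)| = 1 ->
  numerical_radius T = 1.
Proof.
move=> T1 xf fTx.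
have ub : ubound [set `|p.2 (T p.1)| | p in @Pi_set R X] 1.
  move=> _ [[y g] yg <-] /=; apply: (le_trans (Pi_contraction yg _)).
  by apply: (le_trans (T1 _)); have [/= -> _ _ _] := yg.
apply/le_anti/andP; split; first by apply: ge_sup => //; exists 1, (x, f).
by apply: ub_le_sup; [exists 1|exists (x, f)].
Qed.

Lemma linfty_numerical_radius_contraction (T : {linear linfty R -> linfty R}) :
  numerical_radius T = 1 -> forall z, `|T z| <= `|z|.
Proof.
move=> T1.
have convex_le1 (p q r : R) : `|p| <= 1 -> `|q| <= 1 -> `|r| <= 1 ->
    `|(1 + r) / 2 * p + (1 - r) / 2 * q| <= 1.
  move=> p1 q1; rewrite ler_norml => /andP[r0 r1].
  apply: (le_trans (ler_normD _ _)); rewrite !normrM.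
  rewrite (@ger0_norm _ (1 + r)) 1?(@ger0_norm _ (1 - r)) 1?ger0_norm; [|lra..].
  nra.
(* [s] times the [n]-th coordinate is a functional of norm one attaining its norm at [y], so the
   numerical radius bounds [T y n]. *)
have sphere_le (s : R) (y : linfty R) n : `|s| = 1 -> `|y| <= 1 -> y n = s ->
    `|T y n| <= 1.
  move=> s1 y1 yn; have lin_e : linear (fun z : linfty R => s * z n : R^o).
    move=> a u v; rewrite !linftyE.
    by rewrite -[RHS]/(a * (s * u n) + s * v n); ring.
  have [f fE] := exists_linear lin_e.
  have : Pi_set (y, f).
    apply: contraction_Pi => [z||].
    - by rewrite fE normrM s1 mul1r coord_le.
    - by apply/le_anti; rewrite y1 -s1 -yn coord_le.
    - by rewrite fE yn -expr2 -(real_normK (num_real s)) s1 expr1n.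
  by move=> /(numerical_radius_ge T1); rewrite fE normrM s1 mul1r.
have ball_le (z : linfty R) : `|z| <= 1 -> `|T z| <= 1.
  move=> z1; apply: linfty_norm_le => n.
  have zn m : `|z m| <= 1 by exact: le_trans (coord_le z m) z1.
  pose y (s : R) := seq_linfty (fun m => if m == n then s else z m).
  have yb s m : `|s| = 1 -> `|if m == n then s else z m : R| <= 1.
    by move=> s1; case: eqP => // _; rewrite s1.
  have yE s m : `|s| = 1 -> y s m = if m == n then s else z m.
    by move=> s1; apply: (seq_linftyE (b := 1)) => k; exact: yb.
  have Ty s : `|s| = 1 -> `|T (y s) n| <= 1.
    move=> s1; apply: (sphere_le s) => //; last by rewrite yE// eqxx.
    by apply: linfty_norm_le => m; rewrite yE//; exact: yb.
  have n1 : `|1 : R| = 1 by rewrite normr1.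
  have nN1 : `|-1 : R| = 1 by rewrite normrN normr1.
  (* The weights produce [z n] at coordinate [n] and add up to 1 at the others, where [y 1],
     [y (-1)] and [z] agree. *)
  have -> : z = ((1 + z n) / 2) *: y 1 + ((1 - z n) / 2) *: y (-1).
    apply: linfty_ext => m; rewrite !linftyE !yE//.
    by case: eqP => [->|_]; field.
  rewrite linearD !linearZ_LR !linftyE.
  exact: convex_le1 (Ty _ n1) (Ty _ nN1) (zn n).
move=> z; have [->|z0] := eqVneq z 0; first by rewrite linear0 !normr0.
have nz0 : 0 < `|z| by rewrite normr_gt0.
have := ball_le (`|z|^-1 *: z); rewrite linearZ_LR !normrZ normfV normr_id.
by rewrite mulVf ?gt_eqF// lexx ler_pdivrMl// mulr1 => /(_ isT).
Qed.

End OperatorNorm.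

(** * Construction of the perturbed operator, vector and functional *)

Theorem corollary4p8 (R : realType) : BPBp_nu (linfty R).
Proof.
move=> e /andP[e0 e1].
(* [d < e] bounds the move of [x0]; [h / d = e / 8] and [h < e / 16] keep the row error
   [2 * (h + h / d)] below [3 * e / 8]; with [eta = e / 4 * h] Markov's inequality leaves mass above
   [1 - e / 4], so the functional moves by less than [e / 2]. *)
pose d := e / 2; pose h := e ^+ 2 / 16.
have d0 : 0 < d by rewrite /d; lra.
have d12 : d <= 1 / 2 by rewrite /d; lra.
have h0 : 0 < h by rewrite /h divr_gt0 ?exprn_gt0.
have he : h < e / 16 by rewrite /h ltr_pM2r ?invr_gt0// expr2 gtr_pMl.
have hd : h / d = e / 8 by rewrite /h /d; field; rewrite gt_eqF.
exists (e / 4 * h) => [|T x0 f0 _ xf0 nuT f0T]; first by rewrite mulr_gt0// divr_gt0.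
have T1 := linfty_numerical_radius_contraction nuT.
have f01 := Pi_contraction xf0.
have [/= x0_eq1 _ _ f0x0] := xf0.
have x0_1 : `|x0| <= 1 by rewrite x0_eq1.
have linf0 : functional (fun z => f0 z : R) by move=> a x y; rewrite linearPZ.
have [s s1 sf0T] : exists2 s : R, `|s| = 1 & 1 - e / 4 * h < s * f0 (T x0).
  (* The sign has absolute value 1 because [f0 (T x0)] is nonzero, the threshold [1 - e / 4 * h]
     being nonnegative. *)
  exists (Num.sg (f0 (T x0))); last by rewrite -normrEsg.
  rewrite normr_sg; suff -> : f0 (T x0) != 0 by [].
  apply: contraTneq f0T => ->; rewrite normr0 -leNgt; nra.
have ss : s * s = 1 by rewrite -expr2 -(real_normK (num_real s)) s1 expr1n.
pose c n : R := peak x0 d n.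
have c1 n : `|c n| <= 1 by exact: peak_le1.
pose B n := 1 - h < s * (c n * T x0 n).
have Bpeak n : B n -> c n != 0.
  by apply: contraTneq; rewrite /B => ->; rewrite mul0r mulr0 -leNgt; lra.
have cc n : B n -> c n * c n = 1.
  move=> /Bpeak; rewrite /c; case: (peakP d x0_1 n) => -[-> _]; rewrite ?eqxx//.
    by rewrite mulr1.
  by rewrite mulrNN mulr1.
have row_le n z : `|s * (c n * T z n)| <= `|z|.
  rewrite !normrM s1 mul1r -[leRHS]mul1r ler_pM//.
  exact: le_trans (coord_le _ _) (T1 _).
(* Rows outside [B] stay as they are, so nothing is asked of [M n] there and [fun=> 0] serves as a
   default. *)
have [M MP] : exists M : nat -> linfty R -> R, forall n, B n ->
    [/\ functional (M n), forall z, `|M n z| <= `|z|, M n (snap x0 d) = 1 &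
    forall z, `|z| <= 1 -> `|M n z - s * (c n * T z n)| <= 2 * (h + e / 8)].
  suff /choice[M MP] : forall n, exists m : linfty R -> R, B n ->
      [/\ functional m, forall z, `|m z| <= `|z|, m (snap x0 d) = 1 &
      forall z, `|z| <= 1 -> `|m z - s * (c n * T z n)| <= 2 * (h + e / 8)].
    by exists M.
  move=> n; have [Bn|] := boolP (B n); last by exists (fun=> 0).
  have linrow : functional (fun z => s * (c n * T z n)).
    move=> a x y; rewrite linearP !linftyE.
    by rewrite -[RHS]/(a * (s * (c n * T x n)) + s * (c n * T y n)); ring.
  have [||m [m1 m2 m3 m4]] :=
      nearly_attaining_correction x0_1 d0 d12 linrow (row_le n) (t := h).
  - exact: ltW.
  - by rewrite hd; lra.
  - by exists m => _; split=> // z /m4; rewrite hd.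
(* [M n] approximates the row of [T] multiplied by [s * c n]; multiplying once more undoes this, as
   [s * s = 1] and, on [B], [c n * c n = 1]. *)
pose Srow z n : R := if B n then s * (c n * M n z) else T z n.
have Srow_le z n : `|Srow z n| <= `|z|.
  rewrite /Srow; case: ifPn => [/MP[_ M1 _ _]|_].
    by rewrite !normrM s1 mul1r -[leRHS]mul1r ler_pM.
  exact: le_trans (coord_le _ _) (T1 _).
have SE z n : seq_linfty (Srow z) n = Srow z n by exact: seq_linftyE.
have [S SrowE] : exists S : {linear linfty R -> linfty R},
    S =1 fun z => seq_linfty (Srow z).
  apply: exists_linear => a x y; apply: linfty_ext => n.
  rewrite !linftyE !SE /Srow; case: ifPn => [/MP[linM _ _ _]|_].
    by rewrite linM -[a *: _ + _]/(a * M n x + M n y); ring.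
  by rewrite linearP !linftyE.
have {}SE z n : S z n = Srow z n by rewrite SrowE SE.
have S1 z : `|S z| <= `|z| by apply: linfty_norm_le => n; rewrite SE.
(* Markov's inequality with [r = e / 4]: since [f0] sees only the peaks, the two factors [c] cancel
   under it and the value is [s * f0 (T x0)]. *)
have mass : 1 - e / 4 < peak_mass x0 d (fun z => f0 z) B.
  apply: (peak_mass_gt x0_1 d0 d12 linf0 f01 f0x0
    (w := s *: mul_linfty c (T x0)) (h := h)).
  - by lra.
  - move=> n; rewrite linftyE mul_linftyE//.
    by apply: (le_trans (ler_norm _)); apply: le_trans (row_le _ _) x0_1.
  - by move=> n; rewrite linftyE mul_linftyE// /B -leNgt.
  - have -> : mul_linfty c (s *: mul_linfty c (T x0))
        = s *: mul_linfty c (mul_linfty c (T x0)).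
      by apply: linfty_ext => n; rewrite !(mul_linftyE, linftyE)//; ring.
    rewrite (functionalZ linf0) (peak_support x0_1 d0 d12 linf0 f01 f0x0)//.
    exact: le_trans x0_1.
have [|f1' [linf1 f1_le f1_eq f1_near]] :=
  exists_localization x0_1 d0 d12 linf0 f01 f0x0 (B := B).
  by lra.
have [f1 f1E] := exists_linear linf1.
have f1le z : `|f1 z| <= `|z| by rewrite f1E.
have f1snap : f1 (snap x0 d) = 1.
  by rewrite f1E; apply: f1_eq => n Bn; rewrite peak_snap// cc.
have xf1 : Pi_set (snap x0 d, f1).
  apply: contraction_Pi => //; apply/le_anti; rewrite snap_le1//=.
  by have := f1le (snap x0 d); rewrite f1snap normr1.
have f1S : `|f1 (S (snap x0 d))| = 1.
  (* On [B], [M n] takes the value 1 at [snap], so [c n] times the [n]-th coordinate of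
     [S (snap x0 d)] is the constant [s]. *)
  rewrite f1E (f1_eq _ s)// => n Bn; rewrite SE /Srow Bn.
  have [_ _ -> _] := MP _ Bn.
  by rewrite mulr1 mulrCA -/(c n) cc// mulr1.
exists S, (snap x0 d), f1; split=> //; first exact: contraction_bounded.
split=> //.
- exact: numerical_radius_attained xf1 f1S.
- apply: (@le_lt_trans _ _ (2 * (h + e / 8))); last by lra.
  apply: opnorm_le => z z1; apply: linfty_norm_le => n.
  rewrite !linftyE SE /Srow; case: ifPn => [Bn|_]; last first.
    by rewrite subrr normr0; lra.
  have [_ _ _ /(_ z z1)] := MP _ Bn; apply: le_trans.
  have -> : s * (c n * M n z) - T z n = s * c n * (M n z - s * (c n * T z n)).
    have -> : s * c n * (M n z - s * (c n * T z n))
      = s * (c n * M n z) - (s * s) * (c n * c n) * T z n by ring.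
    by rewrite ss cc// !mul1r.
  by rewrite normrM ler_piMl// normrM s1 mul1r.
- by apply: (le_lt_trans (snap_near x0_1 d0 d12)); rewrite /d; lra.
- apply: (@le_lt_trans _ _ (2 * (1 - peak_mass x0 d (fun z => f0 z) B))).
    by apply: opnorm_le => z z1; rewrite /= f1E; exact: f1_near.
  by lra.
Qed.
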